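(* Let $w\mapsto L_w\in\otimes^4\mathfrak h$ be a function defined on all words $w$ on $\{0,1\}$. The map $t\mapsto T^L_t$ defines a weakly scale invariant operator on the direct system $A_Y$, i.e. $\langle T^L_t(\iota_s^t\xi),\iota_s^t\eta\rangle=\langle T^L_s\xi,\eta\rangle$ for all $s\le t$ in $\mathfrak T$ and $\xi,\eta\in\mathcal H_s$, provided $$L_{w0}\,!\,L_{w1}=L_w\quad\text{for all } w .$$
   Context: $\mathfrak h$ is a finite dimensional complex Hilbert space with a fixed orthonormal basis $(e_i)$, and $Y:\mathfrak h\to\mathfrak h\otimes\mathfrak h$ is a linear isometry, $Y e_b=\sum_{x,y}Y_{b,x,y}\,e_x\otimes e_y$. $\mathfrak T$ is the directed set of planar binary rooted trees, with $s\le t$ iff $s$ is a rooted subtree of $t$. The direct system $A_Y$ assigns to a tree $t$ with $k$ leaves the Hilbert space $\mathcal H_t=\otimes^k\mathfrak h$. If $t$ is obtained from $s$ (with $k$ leaves) by attaching a binary branching at the $i$-th leaf (from the left), then $\iota_s^t=\mathrm{id}^{\otimes(i-1)}\otimes Y\otimes\mathrm{id}^{\otimes(k-i)}$; general $\iota_s^t$ are compositions of these. An element $L\in\otimes^4\mathfrak h$ has components $L_{i,j,k,\ell}$ (legs north, east, south, west). For $L_1,\dots,L_k\in\otimes^4\mathfrak h$ the transfer matrix with periodic boundary conditions is the operator on $\otimes^k\mathfrak h$ given by $$T(L_1,\dots,L_k)(e_{s_1}\otimes\cdots\otimes e_{s_k})=\sum_{n_1,\dots,n_k}\ \sum_{v_1,\dots,v_k}\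 \prod_{i=1}^k (L_i)_{n_i,\,v_{i+1},\,s_i,\,v_i}\ e_{n_1}\otimes\cdots\otimes e_{n_k},\qquad v_{k+1}:=v_1 .$$ Each leaf is coded by the word on $\{0,1\}$ read along the path from root to leaf ($0$ left turn, $1$ right turn). If the leaves of $t$, from left to right, have words $w_1,\dots,w_k$, then $T^L_t=T(L_{w_1},\dots,L_{w_k})$. The product $!$ on $\otimes^4\mathfrak h$ is given by the renormalisation tangle ($x$ and $y$ side by side, joined horizontally, with $Y$ below and $Y^*$ above): $$(x\,!\,y)_{n,e,s,w}=\sum_{n_1,n_2,s_1,s_2,m}\overline{Y_{n,n_1,n_2}}\;x_{n_1,m,s_1,w}\;y_{n_2,e,s_2,m}\;Y_{s,s_1,s_2}.$$ *)

(* Defs.v *)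
From HB Require Import structures.
From mathcomp Require Import all_boot all_order all_algebra.

Set Implicit Arguments.
Unset Strict Implicit.
Unset Printing Implicit Defensive.

Import Order.TTheory GRing.Theory Num.Theory.
Local Open Scope ring_scope.

(* Planar binary rooted trees; the first subtree of a Node is the left one. *)
Inductive btree : Type := Leaf | Node of btree & btree.

(* The words of the leaves, from left to right; in a word, false stands for
   the letter 0 (left turn) and true for the letter 1 (right turn). *)
Fixpoint leaf_words (t : btree) : seq (seq bool) :=
  if t is Node l r
  then map (cons false) (leaf_words l) ++ map (cons true) (leaf_words r)
  else [:: [::]].

Definition nleaves (t : btree) : nat := size (leaf_words t).

(* s is a subtree of t with the same root. *)
Fixpoint rooted_subtree (s t : btree) : bool :=
  match s, t with
  | Leaf, _ => true
  | Node _ _, Leaf => false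
  | Node l r, Node l' r' => rooted_subtree l l' && rooted_subtree r r'
  end.

(* Attaches a binary branching at the leaf number i (from the left, starting
   from 0); meaningful for i < nleaves t. *)
Fixpoint attach (t : btree) (i : nat) : btree :=
  match t with
  | Leaf => Node Leaf Leaf
  | Node l r =>
      if (i < nleaves l)%N then Node (attach l i) r
      else Node l (attach r (i - nleaves l))
  end.

Lemma nleaves_Node l r : nleaves (Node l r) = (nleaves l + nleaves r)%N.
Proof. by rewrite /nleaves /= size_cat !size_map. Qed.

Lemma nleaves_attach t i : nleaves (attach t i) = (nleaves t).+1.
Proof.
elim: t i => [|l IHl r IHr] i //=; case: ifP => _;
  by rewrite !nleaves_Node ?IHl ?IHr ?addSn ?addnS.
Qed.

Section TensorPowers.
Variables (C : numClosedFieldType) (d : nat).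

(* The k-th tensor power of a space of dimension d with a fixed orthonormal
   basis e_0, ..., e_(d-1): the value of xi at x is the coefficient of
   e_(x_1) (x) ... (x) e_(x_k) in xi. *)
Definition tensor (k : nat) := {ffun k.-tuple 'I_d -> C^o}.

(* e_(s_1) (x) ... (x) e_(s_k); meaningful for size s = k. Taking a sequence
   rather than a tuple avoids casts between tuple types. *)
Definition basis_tensor k (s : seq 'I_d) : tensor k :=
  [ffun x => (tval x == s)%:R].

Definition tdot k (xi eta : tensor k) : C := \sum_x xi x * (eta x)^*.

Fact tdot_bilinear k :
  bilinear_for (GRing.Scale.Law.clone _ _ *%R _)
    (GRing.Scale.Law.clone _ _ (Num.conj \; *%R) _) (@tdot k).
Proof.
split=> [u' | u] a x y; rewrite /tdot /= mulr_sumr -big_split /=;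
  apply: eq_bigr => i _; rewrite !ffunE ?rmorphD ?rmorphM /=.
- by rewrite mulrDl mulrA.
- by rewrite mulrDr mulrCA.
Qed.

HB.instance Definition _ k :=
  bilinear_isBilinear.Build C (tensor k) (tensor k) C
    (GRing.Scale.Law.clone _ _ *%R _)
    (GRing.Scale.Law.clone _ _ (Num.conj \; *%R) _)
    (@tdot k) (@tdot_bilinear k).

Fact tdot_hermitian k (x y : tensor k) :
  tdot x y = (-1) ^+ false * (tdot y x)^*.
Proof.
rewrite expr0 mul1r /tdot rmorph_sum /=; apply: eq_bigr => i _.
by rewrite rmorphM /= conjCK mulrC.
Qed.

HB.instance Definition _ k :=
  isHermitianSesquilinear.Build C (tensor k) false Num.conj (@tdot k)
    (@tdot_hermitian k).

Fact tdot_gt0 k (x : tensor k) : x != 0 -> 0 < tdot x x.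
Proof.
move=> x_neq0; have [i xi_neq0]: exists i, x i != 0.
  apply/existsP; apply: contraR x_neq0; rewrite negb_exists => /forallP x0.
  by apply/eqP/ffunP => i; rewrite ffunE; apply/eqP; rewrite -[_ == _]negbK.
rewrite /tdot (bigD1 i) //= ltr_wpDr ?mul_conjC_gt0 //.
by apply: sumr_ge0 => j _; apply: mul_conjC_ge0.
Qed.

HB.instance Definition _ k :=
  isDotProduct.Build C (tensor k) (@tdot k) (@tdot_gt0 k).

(* The component L_(n, e, s, w) (north, east, south, west). *)
Definition component (L : tensor 4) (n e s w : 'I_d) : C := L [tuple n; e; s; w].

(* The matrix entry <T(L_1, ..., L_k) e_s, e_n>. The bond variable v_i is on
   the west of L_i and, as ordS is the cyclic successor on 'I_k, v_(k+1) is
   v_1. *)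
Definition transfer_entry k (L : k.-tuple (tensor 4)) (n s : k.-tuple 'I_d) : C :=
  \sum_(v : k.-tuple 'I_d) \prod_(i < k)
    component (tnth L i) (tnth n i) (tnth v (ordS i)) (tnth s i) (tnth v i).

Definition transfer k (L : k.-tuple (tensor 4)) (xi : tensor k) : tensor k :=
  \sum_(s : k.-tuple 'I_d) xi s *:
    \sum_(n : k.-tuple 'I_d) transfer_entry L n s *: basis_tensor k n.

Fact transfer_is_linear k (L : k.-tuple (tensor 4)) : linear (transfer L).
Proof.
move=> a x y; rewrite /transfer scaler_sumr -big_split /=.
by apply: eq_bigr => s _; rewrite !ffunE scalerDl scalerA.
Qed.

HB.instance Definition _ k (L : k.-tuple (tensor 4)) :=
  GRing.isLinear.Build C (tensor k) (tensor k) _ (transfer L)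
    (transfer_is_linear L).

Definition tree_space (t : btree) := tensor (nleaves t).

Definition tree_transfer (L : seq bool -> tensor 4) (t : btree) :
    {linear tree_space t -> tree_space t} :=
  transfer (map_tuple L (in_tuple (leaf_words t))).

Section DirectSystem.
Variables (h : lmodType C) (onb : d.-tuple h) (Y : {linear h -> tensor 2}).

Definition Ycoef (b x y : 'I_d) : C := Y (tnth onb b) [tuple x; y].

(* id (x) Y (x) id with Y on the leg number i (starting from 0). The target
   exponent m is left free so that no cast is needed when m = k + 1 holds only
   propositionally; the map is meaningful for m = k + 1. *)
Definition branch_map k m (i : 'I_k) (xi : tensor k) : tensor m :=
  \sum_(s : k.-tuple 'I_d) xi s *:
    \sum_(x < d) \sum_(y < d) Ycoef (tnth s i) x y *:
      basis_tensor m (take i s ++ [:: x; y] ++ drop i.+1 s).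

(* connecting s t f: f is iota_s^t, as the composition of the elementary maps
   along some sequence of branchings that builds t from s. *)
Inductive connecting (s : btree) :
    forall t : btree, (tree_space s -> tree_space t) -> Prop :=
| connecting_id : connecting (fun xi : tree_space s => xi)
| connecting_branch (t : btree) (f : tree_space s -> tree_space t)
    (i : 'I_(nleaves t)) :
    connecting f ->
    connecting (fun xi => branch_map (nleaves (attach t i)) i (f xi)
                          : tree_space (attach t i)).

Definition weakly_scale_invariant
    (T : forall t : btree, {linear tree_space t -> tree_space t}) : Prop :=
  forall s t : btree, rooted_subtree s t ->
  forall iota : tree_space s -> tree_space t, connecting iota ->
  forall xi eta : tree_space s,
    tdot (T t (iota xi)) (iota eta) = tdot (T s xi) eta.

(* The renormalisation product x ! y. *)
Definition renorm (x y : tensor 4) : tensor 4 :=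
  [ffun z => let n := tnth z 0 in let e := tnth z 1 in
             let s := tnth z 2%:R in let w := tnth z 3%:R in
     \sum_(n1 < d) \sum_(n2 < d) \sum_(s1 < d) \sum_(s2 < d) \sum_(m < d)
       (Ycoef n n1 n2)^* * component x n1 m s1 w *
       component y n2 e s2 m * Ycoef s s1 s2].

Lemma renormE (x y : tensor 4) (n e s w : 'I_d) :
  component (renorm x y) n e s w =
  \sum_(n1 < d) \sum_(n2 < d) \sum_(s1 < d) \sum_(s2 < d) \sum_(m < d)
    (Ycoef n n1 n2)^* * component x n1 m s1 w *
    component y n2 e s2 m * Ycoef s s1 s2.
Proof. by rewrite [LHS]ffunE. Qed.

Lemma connecting_exists s t : rooted_subtree s t ->
  exists f : tree_space s -> tree_space t, connecting f.
Proof.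
pose grows s t := exists f : tree_space s -> tree_space t, connecting f.
have grow1 u v i : (i < nleaves v)%N -> grows u v -> grows u (attach v i).
  by move=> lti [f cf]; eexists; apply: (connecting_branch (Ordinal lti) cf).
have growI (P : btree -> btree -> Prop) :
    (forall u, P u u) ->
    (forall u v i, (i < nleaves v)%N -> P u v -> P u (attach v i)) ->
    forall u v, grows u v -> P u v.
  move=> P0 P1 u v [f]; elim=> // w g i _ Puw.
  exact: P1 (ltn_ord i) Puw.
have grow0 u : grows u u by exists id; apply: connecting_id.
have growT u v w : grows v w -> grows u v -> grows u w.
  move=> gvw guv; move: v w gvw guv.
  apply: growI => // v w i lti IH guv; exact: grow1 lti (IH guv).
have growL l l' r : grows l l' -> grows (Node l r) (Node l' r).
  move: l l'; apply: growI => // l l' i lti IH.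
  have -> : Node (attach l' i) r = attach (Node l' r) i by rewrite /= lti.
  by apply: grow1 => //; rewrite nleaves_Node ltn_addr.
have growR l r r' : grows r r' -> grows (Node l r) (Node l r').
  move: r r'; apply: growI => // r r' i lti IH.
  have -> : Node l (attach r' i) = attach (Node l r') (nleaves l + i).
    by rewrite /= ltnNge leq_addr /= addKn.
  by apply: grow1 => //; rewrite nleaves_Node ltn_add2l.
have growC : grows Leaf (Node Leaf Leaf).
  by rewrite -[Node _ _]/(attach Leaf 0); apply: grow1.
have growLeaf u : grows Leaf u.
  elim: u => // l IHl r IHr.
  exact: growT (growR _ _ _ IHr) (growT _ _ _ (growL _ _ _ IHl) growC).
elim: s t => [|l IHl r IHr] t /=; first by move=> _; apply: growLeaf.
case: t => //= l' r' /andP[ll' rr'].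
exact: growT (growR _ _ _ (IHr _ rr')) (growL _ _ _ (IHl _ ll')).
Qed.

End DirectSystem.
End TensorPowers.

(* Main.v *)
Require Import Defs.
From mathcomp Require Import all_boot all_order all_algebra.
From mathcomp Require Import complex reals.

Set Implicit Arguments.
Unset Strict Implicit.
Unset Printing Implicit Defensive.

Import Order.TTheory GRing.Theory Num.Theory.
Local Open Scope ring_scope.

(** Writing the four-legged tensor L, with its north leg fixed to n and its
    south leg fixed to s, as a matrix [tile L n s] acting along the horizontal
    bonds, the sum over the bond variables of the periodic transfer matrix is
    the trace of a product of tiles:
    <T(L_1, ..., L_k) e_s, e_n> = tr (tile L_1 n_1 s_1 ... tile L_k n_k s_k).
    The renormalisation product is made for this: contracting the product
    tile x n1 s1 * tile y n2 s2 of two neighbouring tiles with the coefficients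
    of Y below and of Y^* above gives tile (x ! y) n s ([tile_renorm]).

    Branching the leaf with word w replaces w by the two words w0, w1 in the
    list of leaf words ([leaf_words_attach]), and correspondingly one tile by
    two neighbouring ones, on which the connecting map puts a Y below and, in
    the second argument of the inner product, a Y^* above.  When
    L_(w0) ! L_(w1) = L_w, the contracted pair is the original tile, so the
    trace is unchanged ([tdot_transfer_branch_basis]).  Since general
    connecting maps are composed of branchings, the invariance follows by
    induction along the composition. *)

(** * Leaf words of a branched tree *)

(** The recursion goes through because prefixing a letter on the way up to the root
    commutes with appending one at the leaf. *)
Lemma leaf_words_attach t i : (i < nleaves t)%N ->
  let w := nth [::] (leaf_words t) i in
  leaf_words (attach t i) =
    take i (leaf_words t) ++ [:: rcons w false; rcons w true] ++
    drop i.+1 (leaf_words t).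
Proof.
elim: t i => [|l IHl r IHr] i; first by case: i.
rewrite nleaves_Node /= => lti.
rewrite take_cat drop_cat nth_cat !size_map -/(nleaves l).
case: ltnP => [ltil | leli] /=.
  rewrite (IHl _ ltil) (nth_map [::]) // !map_cat /= map_take map_drop.
  rewrite -!catA /=; congr (_ ++ _ :: _ :: _).
  case: ltnP => [//|lel].
  (* The branched leaf is the last one of l: nothing of l is left after it. *)
  have -> : i.+1 = nleaves l by apply/eqP; rewrite eqn_leq ltil lel.
  by rewrite subnn drop0 drop_oversize ?size_map.
have ltir : (i - nleaves l < nleaves r)%N by rewrite ltn_subLR.
rewrite (IHr _ ltir) (nth_map [::]) // !map_cat /= map_take map_drop.
by rewrite ltnNge (leq_trans leli) //= subSn // -!catA.
Qed.

(** * Periodic sums as traces *)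

Lemma sum_tuple_cons (V : nmodType) (T : finType) k (F : k.+1.-tuple T -> V) :
  \sum_v F v = \sum_x \sum_(v : k.-tuple T) F (cons_tuple x v).
Proof.
rewrite pair_big /=.
rewrite (reindex (fun p : T * k.-tuple T => cons_tuple p.1 p.2)) //=.
exists (fun v => (thead v, behead_tuple v)) => [[x v] _ | v _] /=.
  by congr pair; apply: val_inj.
by rewrite [RHS]tuple_eta; apply: val_inj.
Qed.

Section Trace.
Variables (C : comPzRingType) (d : nat).

(** The tuple v lists the row indices of the factors; the column index of each
    factor is the row index of the next one, and b for the last factor, hence
    the default value of nth. *)
Lemma mx_prodE k (A : 'I_k -> 'M[C]_d) a b :
  (\prod_(i < k) A i) a b =
    \sum_(v : k.-tuple 'I_d)
      (nth b v 0 == a)%:R * \prod_(i < k) A i (tnth v i) (nth b v i.+1).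
Proof.
elim: k A a => [|k IHk] A a.
  rewrite big_ord0 mxE (big_pred1 [tuple]) => [|v]; last first.
    by apply/esym/eqP; rewrite [v]tuple0.
  by rewrite big_ord0 mulr1 /= eq_sym.
rewrite big_ord_recl sum_tuple_cons mxE.
under eq_bigr do rewrite IHk mulr_sumr.
rewrite exchange_big [RHS]exchange_big /=; apply: eq_bigr => v _.
rewrite [LHS](bigD1 (nth b v 0)) //= [X in _ + X]big1 ?addr0 => [|x neq_x];
  last first.
  by rewrite eq_sym (negPf neq_x) mul0r mulr0.
rewrite [RHS](bigD1 a) //= [X in _ + X]big1 ?addr0 => [|x neq_x]; last first.
  by rewrite (negPf neq_x) mul0r.
rewrite !eqxx !mul1r big_ord_recl /=; congr (_ * _).
by apply: eq_bigr => i _; rewrite tnthS.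
Qed.

(** The trace of the empty product is d, whereas the sum over the empty tuple
    is 1; hence the condition 0 < k. *)
Lemma mxtrace_prodE k (A : 'I_k -> 'M[C]_d) : (0 < k)%N ->
  \tr (\prod_(i < k) A i) =
    \sum_(v : k.-tuple 'I_d) \prod_(i < k) A i (tnth v i) (tnth v (ordS i)).
Proof.
case: k A => // k A _; rewrite /mxtrace.
under eq_bigr do rewrite mx_prodE.
rewrite exchange_big /=; apply: eq_bigr => v _.
have nthv0 b : nth b v 0 = thead v by rewrite [thead v](tnth_nth b).
rewrite [LHS](bigD1 (thead v)) //= [X in _ + X]big1 ?addr0 => [|x neq_x];
  last first.
  by rewrite nthv0 eq_sym (negPf neq_x) mul0r.
rewrite nthv0 eqxx mul1r; apply: eq_bigr => i _; congr (A _ _ _).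
rewrite (tnth_nth (thead v)) /=.
have := ltn_ord i; rewrite leq_eqVlt => /predU1P[-> | lti].
  by rewrite modnn nthv0 nth_default ?size_tuple.
by rewrite modn_small.
Qed.

End Trace.

(** * Transfer matrices as traces *)

Section Transfer.
Variables (C : numClosedFieldType) (d : nat).
Implicit Types (L : tensor C d 4) (n s : 'I_d).

(** One site of the lattice, acting from its west bond to its east bond. *)
Definition tile L n s : 'M[C]_d := \matrix_(w, e) component L n e s w.

Definition tiles (Ls : seq (tensor C d 4)) (ns ss : seq 'I_d) : 'M[C]_d :=
  \prod_(p <- zip Ls (zip ns ss)) tile p.1 p.2.1 p.2.2.

Lemma tiles_cons L Ls n ns s ss :
  tiles (L :: Ls) (n :: ns) (s :: ss) = tile L n s * tiles Ls ns ss.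
Proof. by rewrite /tiles big_cons. Qed.

Lemma tiles_cat Ls1 Ls2 ns1 ns2 ss1 ss2 :
    size Ls1 = size ns1 -> size ns1 = size ss1 ->
  tiles (Ls1 ++ Ls2) (ns1 ++ ns2) (ss1 ++ ss2) =
    tiles Ls1 ns1 ss1 * tiles Ls2 ns2 ss2.
Proof.
move=> eqLn eqns.
by rewrite /tiles !zip_cat // ?big_cat // size_zip -eqns minnn.
Qed.

Lemma transfer_entryE k (Ls : k.-tuple (tensor C d 4)) (ns ss : k.-tuple 'I_d) :
  (0 < k)%N -> transfer_entry Ls ns ss = \tr (tiles Ls ns ss).
Proof.
move=> k_gt0; rewrite /tiles -/(tval (zip_tuple Ls (zip_tuple ns ss))).
rewrite big_tuple mxtrace_prodE //; apply: eq_bigr => v _; apply: eq_bigr => i _.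
rewrite mxE (tnth_nth (tnth Ls i, (tnth v i, tnth v i))).
rewrite !nth_zip ?size_zip ?size_tuple ?minnn //=.
by rewrite -!tnth_nth.
Qed.

Lemma sum_basisE k (c : k.-tuple 'I_d -> C) x :
  (\sum_(s : k.-tuple 'I_d) c s *: basis_tensor C k s) x = c x.
Proof.
rewrite sum_ffunE (bigD1 x) //= !ffunE eqxx [X in _ + X]big1 => [|s neq_sx].
  by rewrite addr0; apply: mulr1.
by rewrite !ffunE eq_sym val_eqE (negPf neq_sx); apply: mulr0.
Qed.

Lemma tensor_basisE k (xi : tensor C d k) :
  xi = \sum_(s : k.-tuple 'I_d) xi s *: basis_tensor C k s.
Proof. by apply/ffunP => x; rewrite sum_basisE. Qed.

Lemma tdot_basisr k (xi : tensor C d k) (n : k.-tuple 'I_d) :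
  tdot xi (basis_tensor C k n) = xi n.
Proof.
rewrite /tdot (bigD1 n) //= ffunE eqxx conjC1 mulr1 big1 ?addr0 // => x neq_xn.
by rewrite ffunE val_eqE (negPf neq_xn) conjC0 mulr0.
Qed.

(** The indices are sequences of the right size, rather than tuples, because
    branching produces concatenations of sequences. *)
Lemma tdot_transfer_basis k (Ls : k.-tuple (tensor C d 4)) ns ss :
    (0 < k)%N -> size ns = k -> size ss = k ->
  tdot (transfer Ls (basis_tensor C k ss)) (basis_tensor C k ns) =
    \tr (tiles Ls ns ss).
Proof.
move=> k_gt0 /eqP sz_ns /eqP sz_ss.
pose n := Tuple sz_ns; pose s := Tuple sz_ss.
rewrite -[RHS](@transfer_entryE k Ls n s k_gt0).
rewrite /transfer (bigD1 s) //= ffunE eqxx scale1r.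
rewrite [X in _ + X]big1 => [|s' neq_s]; last first.
  by rewrite ffunE (_ : (_ == _) = false) ?scale0r //; apply/negbTE.
rewrite addr0 -[basis_tensor C k ns]/(basis_tensor C k n) tdot_basisr.
by rewrite sum_basisE.
Qed.

Section Renormalisation.
Variables (h : lmodType C) (e : d.-tuple h) (Y : {linear h -> tensor C d 2}).

(** Entry by entry this is the definition of the product, the matrix product
    being the sum over the bond m shared by x and y. *)
Lemma tile_renorm (x y : tensor C d 4) n s :
  tile (renorm e Y x y) n s =
    \sum_n1 \sum_n2 \sum_s1 \sum_s2
      ((Ycoef e Y n n1 n2)^* * Ycoef e Y s s1 s2) *:
        (tile x n1 s1 * tile y n2 s2).
Proof.
apply/matrixP => w ea; rewrite mxE renormE summxE.
apply: eq_bigr => n1 _; rewrite summxE; apply: eq_bigr => n2 _.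
rewrite summxE; apply: eq_bigr => s1 _; rewrite summxE; apply: eq_bigr => s2 _.
rewrite !mxE mulr_sumr; apply: eq_bigr => m _.
by rewrite !mxE mulrAC -!mulrA; congr (_ * _); rewrite mulrCA.
Qed.

Let branch_basis k m (i : 'I_k) (s : k.-tuple 'I_d) : tensor C d m :=
  \sum_(x < d) \sum_(y < d) Ycoef e Y (tnth s i) x y *:
    basis_tensor C m (take i s ++ [:: x; y] ++ drop i.+1 s).

(** The tiles away from site i agree on both sides; at site i the two tiles x, y
    contracted with Y and Y^* are the tile of x ! y. The exponent m is free
    because the number of leaves of a branched tree is a successor only
    propositionally. *)
Lemma tdot_transfer_branch_basis k m (i : 'I_k) (Ls : k.-tuple (tensor C d 4))
    (Ls' : m.-tuple (tensor C d 4)) x y (ns ss : k.-tuple 'I_d) :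
    m = k.+1 ->
    Ls' = take i Ls ++ [:: x; y] ++ drop i.+1 Ls :> seq _ ->
    renorm e Y x y = tnth Ls i ->
  tdot (transfer Ls' (branch_basis m i ss)) (branch_basis m i ns) =
    tdot (transfer Ls (basis_tensor C k ss)) (basis_tensor C k ns).
Proof.
move=> eq_m eqLs' renorm_xy.
have k_gt0 : (0 < k)%N by apply: leq_trans (ltn_ord i).
have m_gt0 : (0 < m)%N by rewrite eq_m.
have split_at T (v : k.-tuple T) :
    v = take i v ++ tnth v i :: drop i.+1 v :> seq T.
  by rewrite (tnth_nth (tnth v i)) -drop_nth ?size_tuple // cat_take_drop.
have size_take_i T (v : k.-tuple T) : size (take i v) = i.
  by rewrite size_takel // size_tuple ltnW.
have size_branch (v : k.-tuple 'I_d) a b :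
    size (take i v ++ [:: a; b] ++ drop i.+1 v) = m.
  rewrite !size_cat size_take_i size_drop size_tuple -[size [:: a; b]]/2%N.
  by rewrite addnA addn2 addSn subnKC.
rewrite tdot_transfer_basis ?size_tuple //.
rewrite [in RHS](split_at _ Ls) [in RHS](split_at _ ns) [in RHS](split_at _ ss).
rewrite tiles_cat ?size_take_i // tiles_cons -renorm_xy tile_renorm.
(* Both sides are sums over the legs n1, n2 of the Y^* above and the legs s1,
   s2 of the Y below; they are compared term by term. *)
rewrite mulr_suml mulr_sumr (raddf_sum (@mxtrace C d)).
rewrite /branch_basis linear_sumr /=; apply: eq_bigr => n1 _.
rewrite mulr_suml mulr_sumr (raddf_sum (@mxtrace C d)) linear_sumr /=.
apply: eq_bigr => n2 _.
rewrite mulr_suml mulr_sumr (raddf_sum (@mxtrace C d)) linear_sum linear_sumlz /=.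
apply: eq_bigr => s1 _.
rewrite mulr_suml mulr_sumr (raddf_sum (@mxtrace C d)) linear_sum linear_sumlz /=.
apply: eq_bigr => s2 _.
rewrite [transfer _ _]linearZ linearZlr /= tdot_transfer_basis ?size_branch //.
rewrite eqLs' !tiles_cat ?size_take_i //= !tiles_cons.
by rewrite -!mulmxE -scalemxAl -scalemxAr mxtraceZ !mulmxA mulrCA mulrA.
Qed.

(** Both sides are sesquilinear, so the case of basis vectors suffices. *)
Lemma tdot_transfer_branch_map k m (i : 'I_k) (Ls : k.-tuple (tensor C d 4))
    (Ls' : m.-tuple (tensor C d 4)) x y (xi eta : tensor C d k) :
    m = k.+1 ->
    Ls' = take i Ls ++ [:: x; y] ++ drop i.+1 Ls :> seq _ ->
    renorm e Y x y = tnth Ls i ->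
  tdot (transfer Ls' (branch_map e Y m i xi)) (branch_map e Y m i eta) =
    tdot (transfer Ls xi) eta.
Proof.
move=> eq_m eqLs' renorm_xy.
rewrite [in RHS](tensor_basisE xi) [in RHS](tensor_basisE eta) /branch_map.
rewrite !linear_sum /= !linear_sumlz /=; apply: eq_bigr => s _.
rewrite !linear_sumr /=; apply: eq_bigr => n _.
rewrite [transfer Ls' _]linearZ [transfer Ls _]linearZ !linearZlr /=.
by rewrite (tdot_transfer_branch_basis _ _ eq_m eqLs' renorm_xy).
Qed.

End Renormalisation.
End Transfer.

(** * Invariance along connecting maps *)

(** Each branching uses the renormalisation equation of a single word, that
    of the branched leaf; the invariance propagates along compositions. *)
Lemma tdot_tree_transfer_connecting (C : numClosedFieldType) (d : nat)
    (h : lmodType C) (e : d.-tuple h) (Y : {linear h -> tensor C d 2})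
    (L : seq bool -> tensor C d 4) :
    (forall w, renorm e Y (L (rcons w false)) (L (rcons w true)) = L w) ->
  forall s t (iota : tree_space C d s -> tree_space C d t),
    connecting e Y iota ->
  forall xi eta, tdot (tree_transfer L t (iota xi)) (iota eta) =
                 tdot (tree_transfer L s xi) eta.
Proof.
move=> L_renorm s t iota; elim=> // {iota} {}t f i _ IHf xi eta.
rewrite -IHf; pose w := nth [::] (leaf_words t) i.
apply: (@tdot_transfer_branch_map _ _ _ _ _ _ _ i _ _
          (L (rcons w false)) (L (rcons w true))).
- exact: nleaves_attach.
- by rewrite /= leaf_words_attach // !map_cat map_take map_drop.
by rewrite L_renorm tnth_map (tnth_nth [::]).
Qed.

Theorem proposition3p1
    (R : realType)
    (h : vectType R[i]) (dot : {dot h for Num.conj})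
    (d : nat) (e : d.-tuple h)
    (e_basis : basis_of fullv e) (e_orthonormal : orthonormal dot e)
    (Y : {linear h -> tensor R[i] d 2})
    (Y_isometry : isometry (@tdot R[i] d 2) dot Y)
    (L : seq bool -> tensor R[i] d 4)
    (L_renorm : forall w : seq bool,
       renorm e Y (L (rcons w false)) (L (rcons w true)) = L w) :
  weakly_scale_invariant e Y (tree_transfer L).
Proof. by move=> s t _; apply: tdot_tree_transfer_connecting. Qed.
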